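(* Let $A$ be a GKŻ algebra over a field $\mathbb F$. Then every homomorphic image of $A$ is a GKŻ algebra; that is, for every (two-sided) ideal $I$ of $A$, the quotient $A/I$ is a GKŻ algebra over $\mathbb F$.
   Context: Algebras are associative and unital, not necessarily commutative. $\mathcal U(A)$ denotes the group of units of $A$. A unital algebra $A$ over a field $\mathbb F$ is a GKŻ algebra if every linear functional $\Lambda:A\to\mathbb F$ such that $\Lambda(u)\neq0$ for all $u\in\mathcal U(A)$ and $\Lambda(\mathbf 1_A)=1$ is multiplicative. The zero algebra is allowed here and is a GKŻ algebra according to this definition. *)

(* Defs.v *)
From HB Require Import structures.
From mathcomp Require Import all_boot all_order all_algebra.
From mathcomp Require Import boolp.

Set Implicit Arguments.
Unset Strict Implicit.
Unset Printing Implicit Defensive.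

Import GRing.Theory.
Local Open Scope ring_scope.
Local Open Scope quotient_scope.

(* MathComp's algType requires 1 != 0. The structure below drops that
   requirement, so that the zero algebra is an instance. It is a plain record
   because Hierarchy Builder cannot insert a structure below GRing.LSemiAlgebra
   after the fact. *)
Record pzAlgType (F : fieldType) := PzAlgebra {
  alg_ring : pzRingType;
  alg_scale : F -> alg_ring -> alg_ring;
  alg_scaleA :
    forall a b x, alg_scale a (alg_scale b x) = alg_scale (a * b) x;
  alg_scale1 : left_id 1 alg_scale;
  alg_scaleDr : right_distributive alg_scale +%R;
  alg_scaleDl : forall x, {morph alg_scale^~ x : a b / a + b};
  alg_scaleAl : forall a x y, alg_scale a (x * y) = alg_scale a x * y;
  alg_scaleAr : forall a x y, alg_scale a (x * y) = x * alg_scale a y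
}.

Definition alg_sort (F : fieldType) (A : pzAlgType F) : Type := alg_ring A.
Coercion alg_sort : pzAlgType >-> Sortclass.

HB.instance Definition _ (F : fieldType) (A : pzAlgType F) :=
  GRing.PzRing.on (alg_sort A).
HB.instance Definition _ (F : fieldType) (A : pzAlgType F) :=
  GRing.Zmodule_isLmodule.Build F (alg_sort A)
    (@alg_scaleA F A) (@alg_scale1 F A) (@alg_scaleDr F A) (@alg_scaleDl F A).

Lemma pzscalerAl (F : fieldType) (A : pzAlgType F) (a : F) (x y : A) :
  a *: (x * y) = (a *: x) * y.
Proof. exact: alg_scaleAl. Qed.

Lemma pzscalerAr (F : fieldType) (A : pzAlgType F) (a : F) (x y : A) :
  a *: (x * y) = x * (a *: y).
Proof. exact: alg_scaleAr. Qed.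

Definition pzAlg_of_algType (F : fieldType) (A : algType F) : pzAlgType F :=
  @PzAlgebra F A *:%R (@scalerA F A) (@scale1r F A) (@scalerDr F A)
    (@scalerDl F A) (@scalerAl F A) (@scalerAr F A).

(* GRing.unit is not available here: it needs a unitRingType, i.e. a nonzero
   ring with a decidable unit predicate. *)
Definition invertible (R : pzRingType) (u : R) : Prop :=
  exists v : R, u * v = 1 /\ v * u = 1.

Definition GKZ_algebra (F : fieldType) (A : pzAlgType F) : Prop :=
  forall L : {scalar A},
    (forall u : A, invertible u -> L u <> 0) -> L 1 = 1 ->
  forall x y : A, L (x * y) = L x * L y.

(* Closure under opposites and scaling follows because A is unital. *)
Record ideal (F : fieldType) (A : pzAlgType F) := Ideal {
  ideal_set :> A -> Prop;
  ideal0 : ideal_set 0;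
  idealD : forall x y, ideal_set x -> ideal_set y -> ideal_set (x + y);
  idealMl : forall a x, ideal_set x -> ideal_set (a * x);
  idealMr : forall a x, ideal_set x -> ideal_set (x * a)
}.

Section Quotient.
Variables (F : fieldType) (A : pzAlgType F) (I : ideal A).

Definition ideal_pred : {pred A} := fun x => `[< I x >].

Lemma ideal_predP x : reflect (I x) (x \in ideal_pred).
Proof. exact: asboolP. Qed.

Lemma ideal_pred_zmod_closed : zmod_closed ideal_pred.
Proof.
split=> [|x y /ideal_predP Ix /ideal_predP Iy]; apply/ideal_predP.
  exact: ideal0.
by apply: idealD => //; rewrite -mulN1r; apply: idealMl.
Qed.

HB.instance Definition _ :=
  GRing.isZmodClosed.Build A ideal_pred ideal_pred_zmod_closed.

(* The underlying additive group is MathComp's quotient of A by I; MathComp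
   multiplies cosets only for commutative, nonzero rings. *)
Definition quot_car : Type := Quotient.quot ideal_pred.
HB.instance Definition _ := GRing.Zmodule.on quot_car.

Definition quot_proj (x : A) : quot_car := \pi_(Quotient.quot ideal_pred) x.

Lemma quot_projP x y : quot_proj x = quot_proj y <-> I (x - y).
Proof.
rewrite /quot_proj; split=> [/eqP|Ixy].
  by rewrite -Quotient.idealrBE => /ideal_predP.
by apply/eqP; rewrite -Quotient.idealrBE; apply/ideal_predP.
Qed.

Lemma quot_proj_surj (q : quot_car) : exists x, quot_proj x = q.
Proof. by exists (repr (q : Quotient.quot ideal_pred)); rewrite /quot_proj reprK. Qed.

Lemma quot_proj_is_zmod_morphism : zmod_morphism quot_proj.
Proof. by move=> x y; rewrite /quot_proj raddfB. Qed.

HB.instance Definition _ :=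
  GRing.isZmodMorphism.Build A quot_car quot_proj quot_proj_is_zmod_morphism.

Let rep (q : quot_car) : A := repr (q : Quotient.quot ideal_pred).

Let repK q : quot_proj (rep q) = q.
Proof. by rewrite /quot_proj reprK. Qed.

Definition quot_mul (p q : quot_car) : quot_car := quot_proj (rep p * rep q).
Definition quot_scale (a : F) (q : quot_car) : quot_car :=
  quot_proj (a *: rep q).

Lemma quot_mulE x y : quot_mul (quot_proj x) (quot_proj y) = quot_proj (x * y).
Proof.
apply/quot_projP; set x' := rep _; set y' := rep _.
have Ix : I (x' - x) by apply/quot_projP; rewrite repK.
have Iy : I (y' - y) by apply/quot_projP; rewrite repK.
have -> : x' * y' - x * y = (x' - x) * y' + x * (y' - y).
  by rewrite mulrBl mulrBr addrA subrK.
by apply: idealD; [apply: idealMr | apply: idealMl].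
Qed.

Lemma quot_scaleE a x : quot_scale a (quot_proj x) = quot_proj (a *: x).
Proof.
apply/quot_projP; set x' := rep _.
have Ix : I (x' - x) by apply/quot_projP; rewrite repK.
rewrite -scalerBr -[x' - x]mul1r pzscalerAl.
exact: idealMl.
Qed.

Lemma quot_mulA : associative quot_mul.
Proof.
by move=> p q r; rewrite -(repK p) -(repK q) -(repK r) !quot_mulE mulrA.
Qed.

Lemma quot_mul1l : left_id (quot_proj 1) quot_mul.
Proof. by move=> p; rewrite -(repK p) quot_mulE mul1r. Qed.

Lemma quot_mul1r : right_id (quot_proj 1) quot_mul.
Proof. by move=> p; rewrite -(repK p) quot_mulE mulr1. Qed.

Lemma quot_mulDl : left_distributive quot_mul +%R.
Proof.
move=> p q r; rewrite -(repK p) -(repK q) -(repK r).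
by rewrite -raddfD !quot_mulE mulrDl raddfD.
Qed.

Lemma quot_mulDr : right_distributive quot_mul +%R.
Proof.
move=> p q r; rewrite -(repK p) -(repK q) -(repK r).
by rewrite -raddfD !quot_mulE mulrDr raddfD.
Qed.

HB.instance Definition _ := GRing.Zmodule_isPzRing.Build quot_car
  quot_mulA quot_mul1l quot_mul1r quot_mulDl quot_mulDr.

Lemma quot_scaleA a b q : quot_scale a (quot_scale b q) = quot_scale (a * b) q.
Proof. by rewrite -(repK q) !quot_scaleE scalerA. Qed.

Lemma quot_scale1 : left_id 1 quot_scale.
Proof. by move=> q; rewrite -(repK q) quot_scaleE scale1r. Qed.

Lemma quot_scaleDr : right_distributive quot_scale +%R.
Proof.
move=> a p q; rewrite -(repK p) -(repK q).
by rewrite -raddfD !quot_scaleE scalerDr raddfD.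
Qed.

Lemma quot_scaleDl q : {morph quot_scale^~ q : a b / a + b}.
Proof. by move=> a b; rewrite -(repK q) !quot_scaleE scalerDl raddfD. Qed.

Lemma quot_scaleAl a (p q : quot_car) :
  quot_scale a (p * q) = quot_scale a p * q.
Proof.
rewrite -(repK p) -(repK q) (quot_mulE : forall x y, _ * _ = _).
by rewrite !quot_scaleE pzscalerAl; apply/esym/quot_mulE.
Qed.

Lemma quot_scaleAr a (p q : quot_car) :
  quot_scale a (p * q) = p * quot_scale a q.
Proof.
rewrite -(repK p) -(repK q) (quot_mulE : forall x y, _ * _ = _).
by rewrite !quot_scaleE pzscalerAr; apply/esym/quot_mulE.
Qed.

Definition quot_alg : pzAlgType F :=
  @PzAlgebra F quot_car quot_scale quot_scaleA quot_scale1 quot_scaleDr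
    quot_scaleDl quot_scaleAl quot_scaleAr.

Definition quot_map : A -> quot_alg := quot_proj.

Lemma quot_map_is_zmod_morphism : zmod_morphism quot_map.
Proof. exact: quot_proj_is_zmod_morphism. Qed.

Lemma quot_map_is_monoid_morphism : monoid_morphism quot_map.
Proof. by split=> // x y; apply/esym/quot_mulE. Qed.

Lemma quot_map_is_scalable : scalable quot_map.
Proof. by move=> a x; apply/esym/quot_scaleE. Qed.

HB.instance Definition _ :=
  GRing.isZmodMorphism.Build A quot_alg quot_map quot_map_is_zmod_morphism.
HB.instance Definition _ :=
  GRing.isMonoidMorphism.Build A quot_alg quot_map quot_map_is_monoid_morphism.
HB.instance Definition _ :=
  GRing.isScalable.Build F A quot_alg *:%R quot_map quot_map_is_scalable.

Lemma quot_map_eq x y : quot_map x = quot_map y <-> I (x - y).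
Proof. exact: quot_projP. Qed.

Lemma quot_map_surj (q : quot_alg) : exists x, quot_map x = q.
Proof. exact: quot_proj_surj. Qed.

End Quotient.

(* Main.v *)
(* A functional on the image that is nonzero on units and sends 1 to 1 pulls
   back to such a functional on A, because homomorphisms preserve units. *)
Require Import Defs.
From mathcomp Require Import all_boot all_order all_algebra.
Import GRing.Theory.
Local Open Scope ring_scope.

Lemma invertible_morph (R S : pzRingType) (f : R -> S) (u : R) :
  monoid_morphism f -> invertible u -> invertible (f u).
Proof.
by case=> f1 fM [v [uv vu]]; exists (f v); rewrite -!fM uv vu f1.
Qed.

Lemma GKZ_image (F : fieldType) (A B : pzAlgType F) (f : {linear A -> B}) :
  monoid_morphism f -> (forall b : B, exists a : A, f a = b) ->
  GKZ_algebra A -> GKZ_algebra B.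
Proof.
move=> f_monoid f_surj hA L L_unit L1 x y; have [f1 fM] := f_monoid.
have [a <-] := f_surj x; have [b <-] := f_surj y.
rewrite -fM; apply: (hA (L \o f : {scalar A})) => [u u_inv|] /=.
  exact/L_unit/invertible_morph.
by rewrite f1.
Qed.

Theorem proposition2p18 (F : fieldType) (A : pzAlgType F)
    (hA : GKZ_algebra A) :
  (forall (B : pzAlgType F) (f : {linear A -> B}),
     monoid_morphism f -> (forall b : B, exists a : A, f a = b) ->
     GKZ_algebra B) /\
  (forall I : ideal A, GKZ_algebra (quot_alg I)).
Proof.
split=> [B f f_monoid f_surj | I].
  exact: (GKZ_image F A B f).
apply: (GKZ_image F A (quot_alg I) (@quot_map F A I)) => //.
  exact: quot_map_is_monoid_morphism.
exact: quot_map_surj.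
Qed.
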